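(* Let $\boldsymbol\Upsilon$ be a real symmetric positive definite $3\times 3$ matrix and let $$\mathcal G_\gamma=\Big\{\mathbf U=(D,\mathbf m,E)^\top\in\mathbb R^5\ \Big|\ D>0,\ E-\sqrt{D^2+\mathbf m\boldsymbol\Upsilon\mathbf m^\top}>0\Big\}.$$ Then $\mathcal G_\gamma$ is an open convex set. Moreover, $\lambda\mathbf U'+(1-\lambda)\mathbf U''\in\mathcal G_\gamma$ for any $\mathbf U'\in\mathcal G_\gamma$, any $\mathbf U''\in\overline{\mathcal G}_\gamma$ (the closure of $\mathcal G_\gamma$), and any $\lambda\in(0,1]$.
   Context: $\mathbf U=(D,\mathbf m,E)^\top$ with $D,E\in\mathbb R$ and $\mathbf m\in\mathbb R^3$ a row vector. $\boldsymbol\Upsilon=(\gamma^{ij})$ is the inverse spatial 3-metric at a fixed spacetime point. *)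

(* Defs.v *)
From HB Require Import structures.
From mathcomp Require Import all_boot all_order all_algebra.
From mathcomp Require Import all_classical all_reals all_analysis.

Set Implicit Arguments.
Unset Strict Implicit.
Unset Printing Implicit Defensive.

Import Order.TTheory GRing.Theory Num.Theory.
Import numFieldNormedType.Exports.

Local Open Scope classical_set_scope.
Local Open Scope ring_scope.

(* Symmetry is not included: it is the separate condition [A \is symmetricmx]. *)
Definition posdefmx (R : realType) (n : nat) (A : 'M[R]_n) : Prop :=
  forall v : 'rV[R]_n, v != 0 -> 0 < (v *m A *m v^T) 0 0.

(* A state [U = (D, m, E)^T] is a column vector split as [1 + (3 + 1)], which
   is convertible to [5]; the component [m] is read back as a row vector. *)
Definition density (R : realType) (U : 'cV[R]_(1 + (3 + 1))) : R :=
  usubmx U 0 0.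

Definition momentum (R : realType) (U : 'cV[R]_(1 + (3 + 1))) : 'rV[R]_3 :=
  (usubmx (dsubmx U))^T.

Definition energy (R : realType) (U : 'cV[R]_(1 + (3 + 1))) : R :=
  dsubmx (dsubmx U) 0 0.

Lemma state_decomp (R : realType) (U : 'cV[R]_5) :
  U = (row_mx (density U)%:M (row_mx (momentum U) (energy U)%:M))^T.
Proof.
rewrite /density /momentum /energy !tr_row_mx !tr_scalar_mx trmxK.
by rewrite -!mx11_scalar !vsubmxK.
Qed.

Definition admissible (R : realType) (Y : 'M[R]_3) : set 'cV[R]_5 :=
  [set U | 0 < density U /\
           0 < energy U - Num.sqrt (density U ^+ 2 +
                 (momentum U *m Y *m (momentum U)^T) 0 0)].

(* Main.v *)
(* The map (D, m) |-> sqrt (D^2 + m Y m^T) is the seminorm of a positive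
   semidefinite form, so g(U) = E - sqrt (D^2 + m Y m^T) is continuous, concave
   and positively homogeneous.  Continuity makes the admissible set open and
   gives D >= 0 and g >= 0 on its closure; superadditivity of g then makes any
   combination with a positive weight on an admissible state satisfy D > 0 and
   g > 0. *)
Require Import Defs.
From HB Require Import structures.
From mathcomp Require Import all_boot all_order all_algebra.
From mathcomp Require Import all_classical all_reals all_analysis.
From mathcomp Require Import ring lra.

Set Implicit Arguments.
Unset Strict Implicit.
Unset Printing Implicit Defensive.

Import Order.TTheory GRing.Theory Num.Theory.
Import numFieldNormedType.Exports.

Local Open Scope classical_set_scope.
Local Open Scope ring_scope.

Definition qform (R : realType) (n : nat) (A : 'M[R]_n) (v : 'rV[R]_n) : R :=
  (v *m A *m v^T) 0 0.

(** A nonnegative binary quadratic form has nonpositive discriminant. If [c] is positive, the form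
    is tested at a suitable point; if [c] vanishes, nonnegativity forces [b] to vanish as well. *)
Lemma discriminant_le (R : realFieldType) (a b c : R) :
  (forall s t, 0 <= s ^+ 2 * a + s * t * b + t ^+ 2 * c) ->
  b ^+ 2 <= 4 * a * c.
Proof.
move=> h; have a0 : 0 <= a by have := h 1 0; lra.
have [->|b0] := eqVneq b 0.
  by have := h 0 1; rewrite expr0n /= => c0; rewrite !mulr_ge0//; lra.
have c0 : 0 <= c by have := h 0 1; lra.
have [c1|c1] := eqVneq c 0.
  (* With [c = 0] the form is affine in [t] at [s = 1]; this [t] gives it the value [-1], a
     contradiction. *)
  have := h 1 (- (a + 1) / b).
  by rewrite c1 mulr0 mul1r divfK //; lra.
have cp : 0 < c by rewrite lt_def c1.
(* At [s = 2 * c] the form is minimal in [t] exactly at [t = - b], and its value there is [c] times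
   the quantity to be bounded. *)
have := h (2 * c) (- b).
have -> : (2 * c) ^+ 2 * a + 2 * c * - b * b + (- b) ^+ 2 * c =
  c * (4 * a * c - b ^+ 2) by ring.
by rewrite pmulr_rge0 // subr_ge0.
Qed.

Lemma qformZD (R : realType) (n : nat) (A : 'M[R]_n) (u v : 'rV[R]_n)
    (s t : R) :
  qform A (s *: u + t *: v) = s ^+ 2 * qform A u +
    s * t * ((u *m A *m v^T) 0 0 + (v *m A *m u^T) 0 0) + t ^+ 2 * qform A v.
Proof.
rewrite /qform linearD !linearZ/= !mulmxDl !mulmxDr -!scalemxAl -!scalemxAr.
rewrite !mxE.
ring.
Qed.

(** Minkowski's inequality: after squaring, the pure terms cancel and the cross terms compare by
    Cauchy-Schwarz. *)
Lemma sqrt_qform_convex (R : realType) (n : nat) (A : 'M[R]_n)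
    (u v : 'rV[R]_n) (s t : R) :
  (forall w, 0 <= qform A w) -> 0 <= s -> 0 <= t ->
  Num.sqrt (qform A (s *: u + t *: v)) <=
    s * Num.sqrt (qform A u) + t * Num.sqrt (qform A v).
Proof.
move=> A0 s0 t0.
have r0 : 0 <= s * Num.sqrt (qform A u) + t * Num.sqrt (qform A v).
  by rewrite addr_ge0 ?mulr_ge0 ?sqrtr_ge0.
rewrite -(ger0_norm r0) -sqrtr_sqr ler_wsqrtr // qformZD.
rewrite sqrrD !exprMn !sqr_sqrtr // lerD2r lerD2l.
rewrite mulrACA -mulrnAr ler_wpM2l ?mulr_ge0 //.
(* Cauchy-Schwarz, as the discriminant bound for the form restricted to the combinations of [u] and
   [v]. *)
have d : ((u *m A *m v^T) 0 0 + (v *m A *m u^T) 0 0) ^+ 2 <=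
    4 * qform A u * qform A v.
  by apply: discriminant_le => x y; rewrite -qformZD.
apply: le_trans (ler_norm _) _; rewrite -sqrtr_sqr.
apply: le_trans (ler_wsqrtr d) _.
rewrite (_ : 4 = 2 ^+ 2); last by ring.
by rewrite -mulrA sqrtrM ?sqr_ge0 // sqrtr_sqr ger0_norm // sqrtrM // mulr_natl.
Qed.

(** Absorbs the square of the density into a single form on pairs [(D, m)], so that Minkowski's
    inequality applies to the whole radicand. *)
Lemma qform_block (R : realType) (n : nat) (A : 'M[R]_n) (a : 'M[R]_1)
    (v : 'rV[R]_n) :
  qform (block_mx 1%:M 0 0 A) (row_mx a v) = a 0 0 ^+ 2 + qform A v.
Proof.
rewrite /qform mul_row_block !mulmx0 mulmx1 add0r addr0 tr_row_mx mul_row_col.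
by rewrite [LHS]mxE [X in X + _]mxE big_ord1 mxE.
Qed.

Lemma sqrt_sqr_qform_convex (R : realType) (n : nat) (A : 'M[R]_n)
    (a b s t : R) (u v : 'rV[R]_n) :
  (forall w, 0 <= qform A w) -> 0 <= s -> 0 <= t ->
  Num.sqrt ((s * a + t * b) ^+ 2 + qform A (s *: u + t *: v)) <=
    s * Num.sqrt (a ^+ 2 + qform A u) + t * Num.sqrt (b ^+ 2 + qform A v).
Proof.
move=> A0 s0 t0.
have B0 (w : 'rV[R]_(1 + n)) : 0 <= qform (block_mx 1%:M 0 0 A) w.
  by rewrite -[w]hsubmxK qform_block addr_ge0 ?sqr_ge0.
have := sqrt_qform_convex (row_mx a%:M u) (row_mx b%:M v) B0 s0 t0.
by rewrite !scale_row_mx add_row_mx !qform_block !mxE eqxx !mulr1n.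
Qed.

Lemma posdefmx_qform_ge0 (R : realType) (n : nat) (A : 'M[R]_n) (v : 'rV[R]_n) :
  posdefmx A -> 0 <= qform A v.
Proof.
move=> A0; have [->|v0] := eqVneq v 0; last exact: ltW (A0 _ v0).
by rewrite /qform mul0mx mul0mx mxE.
Qed.

Lemma densityZD (R : realType) (U V : 'cV[R]_5) (s t : R) :
  density (s *: U + t *: V) = s * density U + t * density V.
Proof. by rewrite /density !mxE. Qed.

Lemma energyZD (R : realType) (U V : 'cV[R]_5) (s t : R) :
  energy (s *: U + t *: V) = s * energy U + t * energy V.
Proof. by rewrite /energy !mxE. Qed.

Lemma momentumZD (R : realType) (U V : 'cV[R]_5) (s t : R) :
  momentum (s *: U + t *: V) = s *: momentum U + t *: momentum V.
Proof. by apply/matrixP => i j; rewrite /momentum !mxE. Qed.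

Definition energy_gap (R : realType) (Y : 'M[R]_3) (U : 'cV[R]_5) : R :=
  energy U - Num.sqrt (density U ^+ 2 + qform Y (momentum U)).

(** The energy is linear and the subtracted root is sublinear; the weights need not sum to [1]. *)
Lemma energy_gap_concave (R : realType) (Y : 'M[R]_3) (U V : 'cV[R]_5)
    (s t : R) :
  posdefmx Y -> 0 <= s -> 0 <= t ->
  s * energy_gap Y U + t * energy_gap Y V <= energy_gap Y (s *: U + t *: V).
Proof.
move=> Y0 s0 t0; rewrite /energy_gap energyZD densityZD momentumZD.
have := @sqrt_sqr_qform_convex _ _ Y (density U) (density V) s t (momentum U)
  (momentum V) (fun w => posdefmx_qform_ge0 w Y0) s0 t0.
lra.
Qed.

Lemma density_continuous (R : realType) :
  continuous (@density R : 'cV[R]_5 -> R).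
Proof.
rewrite (_ : @density R =
    fun U : 'cV[R]_(1 + (3 + 1)) => U (lshift (3 + 1) (0 : 'I_1)) 0).
  exact: coord_continuous.
by apply/funext => U; rewrite /density mxE.
Qed.

Lemma energy_continuous (R : realType) :
  continuous (@energy R : 'cV[R]_5 -> R).
Proof.
rewrite (_ : @energy R =
    fun U : 'cV[R]_(1 + (3 + 1)) => U (rshift 1 (rshift 3 (0 : 'I_1))) 0).
  exact: coord_continuous.
by apply/funext => U; rewrite /energy !mxE.
Qed.

(** Expanded in coordinates, the form is a polynomial in the entries of the state. *)
Lemma qform_momentum_continuous (R : realType) (Y : 'M[R]_3) :
  continuous (fun U : 'cV[R]_5 => qform Y (momentum U)).
Proof.
pose m (j : 'I_3) (U : 'cV[R]_(1 + (3 + 1))) := U (rshift 1 (lshift 1 j)) 0.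
have mc j : continuous (m j) by exact: coord_continuous.
have sumc (F : 'I_3 -> 'cV[R]_5 -> R) :
    (forall j, continuous (F j)) -> continuous (fun U => \sum_j F j U).
  move=> Fc.
  apply: (@continuous_big R _ _ 0 xpredT (@add_continuous R)) => j _.
  exact: Fc.
have mulc (f g : 'cV[R]_5 -> R) :
    continuous f -> continuous g -> continuous (fun U => f U * g U).
  by move=> fc gc U; apply: continuousM; [exact: fc|exact: gc].
rewrite (_ : (fun U => _) =
    fun U : 'cV[R]_5 => \sum_(j < 3) (\sum_(k < 3) m k U * Y k j) * m j U).
  apply: (sumc _) => j; apply: (mulc _ _) => //.
  apply: (sumc (fun k U => m k U * Y k j)) => k.
  by apply: (mulc (m k) (fun=> Y k j)) => //; exact: cst_continuous.
apply/funext => U; rewrite /qform mxE; apply: eq_bigr => j _.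
rewrite !mxE; congr (_ * _).
by apply: eq_bigr => k _; rewrite /momentum !mxE.
Qed.

Lemma energy_gap_continuous (R : realType) (Y : 'M[R]_3) :
  continuous (energy_gap Y).
Proof.
move=> U; apply: continuousB; first exact: energy_continuous.
apply: (continuous_comp _ (@sqrt_continuous R _)).
apply: continuousD; last exact: qform_momentum_continuous.
by apply: continuousM; exact: density_continuous.
Qed.

(** Holds by conversion, since [energy_gap] and [qform] unfold to the expression in [admissible]. *)
Lemma admissible_setI (R : realType) (Y : 'M[R]_3) :
  admissible Y =
  (@density R @^-1` [set x | 0 < x]) `&` (energy_gap Y @^-1` [set x | 0 < x]).
Proof. by []. Qed.

Lemma open_admissible (R : realType) (Y : 'M[R]_3) : open (admissible Y).
Proof.
rewrite admissible_setI; apply: openI; apply: open_comp; do ?exact: open_gt.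
  by move=> U _; exact: density_continuous.
by move=> U _; exact: energy_gap_continuous.
Qed.

Lemma closure_admissible (R : realType) (Y : 'M[R]_3) (U : 'cV[R]_5) :
  closure (admissible Y) U -> 0 <= density U /\ 0 <= energy_gap Y U.
Proof.
(* Relaxing both strict inequalities gives a closed superset, which therefore contains the
   closure. *)
pose C := (@density R @^-1` [set x | 0 <= x]) `&`
  (energy_gap Y @^-1` [set x | 0 <= x]).
have Ccl : closed C.
  apply: closedI; apply: preimage_closed; do ?exact: closed_ge.
    by move=> V _; exact: density_continuous.
  by move=> V _; exact: energy_gap_continuous.
have AC : admissible Y `<=` C by move=> V [D0 E0]; split; exact: ltW.
by move/(closureS AC); rewrite -((closure_id C).1 Ccl).
Qed.

Lemma admissible_conv_closure (R : realType) (Y : 'M[R]_3) (U V : 'cV[R]_5)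
    (l : R) :
  posdefmx Y -> admissible Y U -> closure (admissible Y) V -> 0 < l <= 1 ->
  admissible Y (l *: U + (1 - l) *: V).
Proof.
move=> Y0 [DU EU] /closure_admissible[DV EV] /andP[l0 l1].
have l2 : 0 <= 1 - l by rewrite subr_ge0.
split.
  by rewrite densityZD ltr_pwDl ?mulr_gt0 ?mulr_ge0.
apply: lt_le_trans (energy_gap_concave U V Y0 (ltW l0) l2).
(* Strictness comes from [U], whose weight [l] is positive; [V] contributes a nonnegative term. *)
by rewrite ltr_pwDl ?mulr_gt0 ?mulr_ge0.
Qed.

Theorem lemma2 (R : realType) (Y : 'M[R]_3)
    (Ysym : Y \is symmetricmx) (Ypos : posdefmx Y) :
  [/\ open (admissible Y),
      @convex_set R 'cV[R]_5 (admissible Y) &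
      forall (U' U'' : 'cV[R]_5) (lambda : R),
        admissible Y U' -> closure (admissible Y) U'' ->
        0 < lambda <= 1 ->
        admissible Y (lambda *: U' + (1 - lambda) *: U'')].
Proof.
split.
- exact: open_admissible.
(* Weights strictly between [0] and [1] suffice, and as a set lies in its closure, convexity is an
   instance of the closure statement. *)
- apply/convex_setW => U V /set_mem AU /set_mem AV k k0 k1; apply/mem_set.
  apply: admissible_conv_closure => //; first exact: subset_closure.
  by rewrite k0 ltW.
- by move=> U V l AU AV l01; exact: admissible_conv_closure.
Qed.
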